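(* Let $\varphi$ be an imaginary Codazzi spinor on a Riemannian (spin) manifold $(M,g_0)$ with invertible Codazzi tensor $A$. Then the corresponding spinor $\overline\varphi=\Phi_A(\varphi)$ on $(M,A^*g_0)$ is a Killing spinor with Killing number $i$. Vice versa, given a Riemannian (spin) manifold $(M,g_0)$ with a Killing spinor $\phi$ to the Killing number $ia$ for some real number $a$ and with an invertible Codazzi tensor $A$, on the Riemannian manifold $(M,A^*g_0)$ the spinor field $\Phi_A(\phi)=\overline\phi$ is a Codazzi spinor with Codazzi tensor $aA^{-1}$. Likewise, $\Phi_A$ maps parallel spinor fields (if they exist) to parallel spinor fields.
   Context: A Codazzi tensor on $(M,g_0)$ is a $g_0$-symmetric endomorphism field $A$ with $(\nabla_XA)(Y)=(\nabla_YA)(X)$. $A^*g_0(X,Y):=g_0(AX,AY)$. With Clifford multiplication $\star$ on the complex spinor bundle ($X\star X=-|X|^2$): an imaginary Codazzi spinor to the Codazzi tensor $A$ is a spinor field with $\nabla_X\varphi=i\,A(X)\star\varphi$ for all $X$; a Killing spinor with Killing number $\mu\in\mathbb{C}$ is a spinor field with $\nabla_X\varphi=\mu\,X\star\varphi$ for all $X$. For an invertible Codazzi tensor $A$ there is an obvious identification of the spin structures of $(M,g_0)$ and $(M,A^*g_0)$, covering the bundle map $(s_1,\dots,s_n)\mapsto(A^{-1}s_1,\dots,A^{-1}s_n)$ of orthonormal frames (with $M$ oriented in the target so that this map preserves orientations). $\Phi_A:S_{(M,g_0)}\to S_{(M,A^*g_0)}$, $\varphi\mapsto\overline\varphi$,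 denotes the corresponding isomorphism of spinor bundles; the Clifford products satisfy $\overline{X\star\varphi}=A^{-1}(X)\star\overline\varphi$. *)

(* Defs.v *)
From HB Require Import structures.
From mathcomp Require Import all_boot all_order all_algebra.
From mathcomp Require Import all_classical all_reals all_analysis.
From mathcomp Require Import complex.

Set Implicit Arguments.
Unset Strict Implicit.
Unset Printing Implicit Defensive.

Import Order.TTheory GRing.Theory Num.Theory.
Import numFieldNormedType.Exports.

Local Open Scope classical_set_scope.
Local Open Scope ring_scope.

(** Conventions.  A tangent vector at [x] is the row vector of its components
    in the distinguished chart [chart_at x]; tensors at [x] are matrices in the
    same basis.  Linear maps act on row vectors from the right: [A X] is
    [X *m A], [g(X, Y)] is [X *m g *m Y^T], and row [k] of a frame matrix is
    the [k]-th vector of the frame. *)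

Section Smoothness.
Context {R : realType} {n : nat}.

Fixpoint Ck {V : normedModType R} (k : nat) (U : set 'rV[R]_n)
    (f : 'rV[R]_n -> V) : Prop :=
  match k with
  | 0%N => forall u, U u -> {for u, continuous f}
  | k'.+1 => (forall u, U u -> differentiable f u) /\
             (forall v, Ck k' U (fun u => 'D_v f u))
  end.

Definition smooth {V : normedModType R} (U : set 'rV[R]_n)
  (f : 'rV[R]_n -> V) : Prop := forall k, Ck k U f.

End Smoothness.

Record manifold (R : realType) (n : nat) := Manifold {
  mpoint :> topologicalType;
  m_hausdorff : hausdorff_space mpoint;
  m_second_countable : @second_countable mpoint;
  chart : Type;
  cdom : chart -> set mpoint;
  cmap : chart -> mpoint -> 'rV[R]_n;
  cinv : chart -> 'rV[R]_n -> mpoint;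
  cdom_open : forall c, open (cdom c);
  cimg_open : forall c, open (cmap c @` cdom c);
  cmapK : forall c x, cdom c x -> cinv c (cmap c x) = x;
  cmap_continuous : forall c x, cdom c x -> {for x, continuous (cmap c)};
  cinv_continuous : forall c u, (cmap c @` cdom c) u ->
    {for u, continuous (cinv c)};
  transition_smooth : forall c c',
    smooth (cmap c @` (cdom c `&` cdom c')) (cmap c' \o cinv c);
  chart_at : mpoint -> chart;
  chart_atP : forall x, cdom (chart_at x) x
}.

Section Geometry.
Context {R : realType} {n : nat} {M : manifold R n}.
Implicit Types (x y : M) (c : chart M) (U : set M).

Definition change (c c' : chart M) (x : M) : 'M[R]_n :=
  jacobian (cmap c' \o cinv c) (cmap c x).

(** [f c] is the representation of a field in the chart [c]. *)
Definition smooth_field {V : normedModType R} (U : set M)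
    (f : chart M -> M -> V) : Prop :=
  forall c, smooth (cmap c @` (U `&` cdom c)) (f c \o cinv c).

Definition vec_chart (X : M -> 'rV[R]_n) (c : chart M) (y : M) : 'rV[R]_n :=
  X y *m change (chart_at y) c y.
Definition end_chart (A : M -> 'M[R]_n) (c : chart M) (y : M) : 'M[R]_n :=
  change c (chart_at y) y *m A y *m change (chart_at y) c y.
Definition form_chart (g : M -> 'M[R]_n) (c : chart M) (y : M) : 'M[R]_n :=
  change c (chart_at y) y *m g y *m (change c (chart_at y) y)^T.

Definition smooth_vec (U : set M) (X : M -> 'rV[R]_n) : Prop :=
  smooth_field U (vec_chart X).
Definition smooth_end (A : M -> 'M[R]_n) : Prop :=
  smooth_field setT (end_chart A).
Definition smooth_form (g : M -> 'M[R]_n) : Prop :=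
  smooth_field setT (form_chart g).

Definition inner (g : M -> 'M[R]_n) (x : M) (X Y : 'rV[R]_n) : R :=
  (X *m g x *m Y^T) 0 0.

Definition riemannian_metric (g : M -> 'M[R]_n) : Prop :=
  [/\ smooth_form g,
      forall x X Y, inner g x X Y = inner g x Y X &
      forall x X, X != 0 -> 0 < inner g x X X].

Definition christoffel (g : M -> 'M[R]_n) (c : chart M) (u : 'rV[R]_n)
    (k i j : 'I_n) : R :=
  let G := form_chart g c \o cinv c in
  let dG (l : 'I_n) : 'M[R]_n := 'D_(delta_mx 0 l) G u in
  2^-1 * \sum_l invmx (G u) k l * (dG i j l + dG j i l - dG l i j).

(** The Levi-Civita covariant derivative of [Y] at [x] in the direction [X],
    computed in the distinguished chart at [x]. *)
Definition nabla (g : M -> 'M[R]_n) (Y : M -> 'rV[R]_n) (x : M)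
    (X : 'rV[R]_n) : 'rV[R]_n :=
  let c := chart_at x in
  'D_X (vec_chart Y c \o cinv c) (cmap c x) +
  \row_k \sum_i \sum_j christoffel g c (cmap c x) k i j * X 0 i * Y x 0 j.

Definition app_end (A : M -> 'M[R]_n) (Y : M -> 'rV[R]_n) : M -> 'rV[R]_n :=
  fun y => Y y *m A y.

(** The value at [x] of [(nabla_X A) Y = nabla_X (A Y) - A (nabla_X Y)]. *)
Definition nabla_end (g A : M -> 'M[R]_n) (X Y : M -> 'rV[R]_n)
    (x : M) : 'rV[R]_n :=
  nabla g (app_end A Y) x (X x) - nabla g Y x (X x) *m A x.

(** [X] and [Y] are local vector fields: [nabla_end] is tensorial in both. *)
Definition codazzi_tensor (g A : M -> 'M[R]_n) : Prop :=
  [/\ smooth_end A,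
      forall x X Y, inner g x (X *m A x) Y = inner g x X (Y *m A x) &
      forall (U : set M) X Y, open U -> smooth_vec U X -> smooth_vec U Y ->
        forall x, U x -> nabla_end g A X Y x = nabla_end g A Y X x].

Definition invertible_end (A : M -> 'M[R]_n) : Prop :=
  forall x, A x \in unitmx.

Definition inv_end (A : M -> 'M[R]_n) : M -> 'M[R]_n := fun x => invmx (A x).

(** [(A^* g)(X, Y) = g(A X, A Y)]. *)
Definition pull_metric (A g : M -> 'M[R]_n) : M -> 'M[R]_n :=
  fun x => A x *m g x *m (A x)^T.

(** An orientation is recorded as the sign [o x] of the coordinate basis of
    [chart_at x]; it has to be locally constant when read in a fixed chart. *)
Definition orientation (o : M -> R) : Prop :=
  (forall x, o x = 1 \/ o x = -1) /\
  (forall c x, cdom c x -> \forall y \near x,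
     o y * Num.sg (\det (change (chart_at y) c y)) =
     o x * Num.sg (\det (change (chart_at x) c x))).

Definition pos_frame (o : M -> R) (x : M) (E : 'M[R]_n) : Prop :=
  0 < o x * \det E.

(** The orientation for which [E |-> A^-1 E] maps positive frames to positive
    frames. *)
Definition push_orientation (A : M -> 'M[R]_n) (o : M -> R) : M -> R :=
  fun x => o x * Num.sg (\det (A x)).

Definition smooth_complex {p q : nat} (U : set M)
    (f : M -> 'M[R[i]]_(p, q)) : Prop :=
  smooth_field U (fun _ y => map_mx (@complex.Re R) (f y)) /\
  smooth_field U (fun _ y => map_mx (@complex.Im R) (f y)).

Definition deriv_complex {p q : nat} (f : M -> 'M[R[i]]_(p, q)) (x : M)
    (X : 'rV[R]_n) : 'M[R[i]]_(p, q) :=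
  let c := chart_at x in
  let part (h : R[i] -> R) : 'M[R]_(p, q) :=
    'D_X (fun u => map_mx h (f (cinv c u))) (cmap c x) in
  \matrix_(i, j) (part (@complex.Re R) i j +i* part (@complex.Im R) i j)%C.

End Geometry.

(** Spinor module: an irreducible complex representation of the Clifford
    algebra of [R^n], given by the action of the canonical basis on column
    vectors. *)
Record spinor_module (R : realType) (n : nat) := SpinorModule {
  sdim : nat;
  gam : 'I_n -> 'M[R[i]]_sdim;
  gam_rel : forall k l,
    gam k *m gam l + gam l *m gam k = (- (k == l)%:R *+ 2)%:M;
  sdim_gt0 : (0 < sdim)%N;
  gam_irr : forall W : 'M[R[i]]_sdim,
    (forall k, ((gam k *m W)^T <= W^T)%MS) -> W = 0 \/ W \in unitmx
}.

Section Spin.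
Context {R : realType} {n : nat} (S : spinor_module R n).
Notation D := (sdim S).

Definition cliff (v : 'rV[R]_n) : 'M[R[i]]_D :=
  \sum_k (v 0 k)%:C%C *: gam S k.

(** [Spin n], realised by its action on the spinor module, which is faithful
    on the even part of the Clifford algebra: the products of evenly many unit
    vectors. *)
Inductive spin : 'M[R[i]]_D -> Prop :=
| spin1 : spin 1%:M
| spinM u v h : u *m u^T = 1%:M -> v *m v^T = 1%:M -> spin h ->
    spin (cliff u *m cliff v *m h).

(** [B] is the image of [h] under the covering [Spin n -> SO n]. *)
Definition spin_cover (h : 'M[R[i]]_D) (B : 'M[R]_n) : Prop :=
  forall v, h *m cliff v *m invmx h = cliff (v *m B).

End Spin.

(** Smooth compatibility on [W] of two local sections of a [Spin n]-bundle. *)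
Definition smooth_transition (R : realType) (n : nat) (M : manifold R n)
    (S : spinor_module R n) (P : Type) (act : P -> 'M[R[i]]_(sdim S) -> P)
    (W : set M) (s t : M -> P) : Prop :=
  exists h : M -> 'M[R[i]]_(sdim S),
    (forall x, W x -> spin (h x) /\ t x = act (s x) (h x)) /\
    smooth_complex W h.

(** A spin structure on the Riemannian manifold [(M, g)] oriented by [o]: a
    principal [Spin n]-bundle [P] with an equivariant map [frame] to the
    positive orthonormal frames.  The smooth structure of [P] is given by its
    (maximal) system of smooth local sections: [psec U s] means that [s] is a
    smooth section over the open set [U]; the values of [s] outside [U] are
    irrelevant. The action [pact] is only meaningful on [spin] elements. *)
Record spin_structure (R : realType) (n : nat) (S : spinor_module R n)
    (M : manifold R n) (g : M -> 'M[R]_n) (o : M -> R) := SpinStructure {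
  pspin : Type;
  pproj : pspin -> M;
  pact : pspin -> 'M[R[i]]_(sdim S) -> pspin;
  pact1 : forall p, pact p 1%:M = p;
  pactM : forall p h h', spin h -> spin h' ->
    pact p (h *m h') = pact (pact p h) h';
  pproj_act : forall p h, spin h -> pproj (pact p h) = pproj p;
  pact_free_transitive : forall p q, pproj p = pproj q ->
    exists! h, spin h /\ q = pact p h;
  psec : set M -> (M -> pspin) -> Prop;
  psecP : forall U s, psec U s <->
    [/\ open U, forall x, U x -> pproj (s x) = x &
        forall V t, psec V t -> smooth_transition pact (U `&` V) s t];
  psec_cover : forall x, exists U s, psec U s /\ U x;
  frame : pspin -> 'M[R]_n;
  frame_orthonormal : forall p,
    frame p *m g (pproj p) *m (frame p)^T = 1%:M;
  frame_pos : forall p, pos_frame o (pproj p) (frame p);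
  frame_act : forall p h B, spin h -> spin_cover h B ->
    frame (pact p h) = B *m frame p;
  frame_smooth : forall U s, psec U s ->
    forall k, smooth_vec U (fun x => row k (frame (s x)))
}.

Section Spinors.
Context {R : realType} {n : nat} {S : spinor_module R n} {M : manifold R n}
  {g : M -> 'M[R]_n} {o : M -> R} (Q : spin_structure S g o).

(** A section of the spinor bundle [P x_Spin S] as an equivariant map: the
    spinor at [x] is the class of [(p, phi p)] for any [p] over [x]. *)
Definition spinor_field (phi : pspin Q -> 'cV[R[i]]_(sdim S)) : Prop :=
  (forall p h, spin h -> phi (pact p h) = invmx h *m phi p) /\
  (forall U s, psec U s -> smooth_complex U (phi \o s)).

(** Clifford multiplication of [(p, psi)] with a tangent vector [X] acts
    through the components of [X] in the frame of [p]. *)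
Definition cliff_mul (p : pspin Q) (X : 'rV[R]_n)
    (psi : 'cV[R[i]]_(sdim S)) : 'cV[R[i]]_(sdim S) :=
  cliff S (X *m invmx (frame p)) *m psi.

(** The spinor connection in the gauge [s], i.e. [nabla_X phi] at [x] is the
    class of [(s x, nabla_spin phi s x X)], where for the frame
    [e = frame \o s]
    [nabla_X phi = X(phi) + 1/4 sum_(k,l) g(nabla_X e_k, e_l) e_k e_l phi]. *)
Definition nabla_spin (phi : pspin Q -> 'cV[R[i]]_(sdim S)) (s : M -> pspin Q)
    (x : M) (X : 'rV[R]_n) : 'cV[R[i]]_(sdim S) :=
  let e (k : 'I_n) : M -> 'rV[R]_n := fun y => row k (frame (s y)) in
  deriv_complex (phi \o s) x X +
  4^-1 *: \sum_k \sum_l (inner g x (nabla g (e k) x X) (e l x))%:C%C *: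
            (gam S k *m gam S l *m phi (s x)).

Definition killing_spinor (mu : R[i])
    (phi : pspin Q -> 'cV[R[i]]_(sdim S)) : Prop :=
  spinor_field phi /\
  forall U s, psec U s -> forall x, U x -> forall X,
    nabla_spin phi s x X = mu *: cliff_mul (s x) X (phi (s x)).

Definition parallel_spinor (phi : pspin Q -> 'cV[R[i]]_(sdim S)) : Prop :=
  spinor_field phi /\
  forall U s, psec U s -> forall x, U x -> forall X, nabla_spin phi s x X = 0.

Definition imaginary_codazzi_spinor (A : M -> 'M[R]_n)
    (phi : pspin Q -> 'cV[R[i]]_(sdim S)) : Prop :=
  [/\ codazzi_tensor g A, spinor_field phi &
      forall U s, psec U s -> forall x, U x -> forall X,
        nabla_spin phi s x X = 'i%C *: cliff_mul (s x) (X *m A x) (phi (s x))].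

End Spinors.

(** An identification of spin structures of [(M, g)] and [(M, A^* g)]: an
    isomorphism of [Spin n]-bundles covering the map of frames
    [(s_1, .., s_n) |-> (A^-1 s_1, .., A^-1 s_n)]. *)
Record spin_identification (R : realType) (n : nat) (S : spinor_module R n)
    (M : manifold R n) (g : M -> 'M[R]_n) (o : M -> R) (A : M -> 'M[R]_n)
    (Q : spin_structure S g o)
    (Q' : spin_structure S (pull_metric A g) (push_orientation A o)) :=
  SpinIdentification {
  idf : pspin Q -> pspin Q';
  idi : pspin Q' -> pspin Q;
  idfK : cancel idf idi;
  idiK : cancel idi idf;
  idf_proj : forall p, pproj (idf p) = pproj p;
  idf_act : forall p h, spin h -> idf (pact p h) = pact (idf p) h;
  idf_smooth : forall U s, psec U s <-> psec U (idf \o s);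
  idf_frame : forall p, frame (idf p) = frame p *m invmx (A (pproj p))
}.

(** The induced isomorphism of spinor bundles maps the class of [(p, psi)] to
    the class of [(idf p, psi)]. *)
Definition Phi (R : realType) (n : nat) (S : spinor_module R n)
    (M : manifold R n) (g : M -> 'M[R]_n) (o : M -> R) (A : M -> 'M[R]_n)
    (Q : spin_structure S g o)
    (Q' : spin_structure S (pull_metric A g) (push_orientation A o))
    (F : spin_identification Q Q') (phi : pspin Q -> 'cV[R[i]]_(sdim S)) :
    pspin Q' -> 'cV[R[i]]_(sdim S) :=
  phi \o idi F.

(* Main.v *)
Require Import Defs.
From HB Require Import structures.
From mathcomp Require Import all_boot all_order all_algebra.
From mathcomp Require Import all_classical all_reals all_analysis.
From mathcomp Require Import complex.
From mathcomp Require Import perm ring.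
Set Implicit Arguments.
Unset Strict Implicit.
Unset Printing Implicit Defensive.
Import Order.TTheory GRing.Theory Num.Theory.
Import numFieldNormedType.Exports.
Local Open Scope classical_set_scope.
Local Open Scope ring_scope.

(** The Levi-Civita connection of [A^* g] is [nabla'_X Y = A^-1 nabla_X (A Y)]:
    the right-hand side is metric for [A^* g], and it is torsion-free because
    [A] is Codazzi.  Hence [g'(nabla'_X e'_k, e'_l) = g(nabla_X e_k, e_l)] for
    the frames [e' = A^-1 e], so that in corresponding gauges the two spinor
    connections are the same operator, while Clifford multiplication by [X]
    becomes Clifford multiplication by [A X].  The same formula gives
    [(nabla'_X A^-1) Y = - A^-2 (nabla_X A) Y], so [a A^-1] is Codazzi for
    [A^* g]. *)

(** * Germs of maps and differentiation of matrix-valued functions *)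

Lemma near_in_open (T : topologicalType) (U : set T) (P : T -> Prop) (x : T) :
  open U -> U x -> (forall y, U y -> P y) -> \forall y \near x, P y.
Proof.
move=> oU Ux UP; have : nbhs x U by apply: open_nbhs_nbhs; split.
exact: filterS.
Qed.

(** The remainder of the first-order expansion is a little-o at the point, hence depends only on the
    germ; so the differential of [f] also serves as that of [g]. *)
Lemma near_eq_differentiable (R : numFieldType) (V W : normedModType R)
    (f g : V -> W) (x : V) :
  (\near x, f x = g x) -> differentiable f x -> differentiable g x.
Proof.
move=> fg /diff_locallyP [cdf ef].
have fgx : f x = g x := nbhs_singleton fg.
have eg : g \o shift x = cst (g x) + 'd f x +o_ 0 id.
  apply/eqaddoP => e e0.
  move/eqaddoP : ef => /(_ _ e0) ef.
  have fg0 : \forall h \near (0 : V), f (h + x) = g (h + x).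
    by move: fg; rewrite (near_shift 0 x) subr0.
  near=> h; suff <- : (f \o shift x - (cst (f x) + 'd f x)) h =
                     (g \o shift x - (cst (g x) + 'd f x)) h by near: h.
  rewrite !fctE /= -fgx; congr (_ - _).
  by near: h.
apply/diff_locallyP; have dg : 'd g x = 'd f x :> (V -> W).
  by apply: diff_unique.
by rewrite dg.
Unshelve. all: by end_near. Qed.

Section MatrixCalculus.
Context {R : realType} {V : normedModType R}.

Lemma differentiable_mxP (m n : nat) (f : V -> 'M[R]_(m, n)) (x : V) :
  differentiable f x <-> forall i j, differentiable (fun u => f u i j) x.
Proof.
split=> [df i j|df].
  exact: (differentiable_comp df (differentiable_coord _ _ _)).
have -> : f = \sum_i \sum_j (fun u => f u i j *: delta_mx i j).
  apply/funext => u; rewrite {1}(matrix_sum_delta (f u)) fct_sumE.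
  by apply: eq_bigr => i _; rewrite fct_sumE.
apply: differentiable_sum => i; apply: differentiable_sum => j.
exact: differentiableZl.
Qed.

Lemma derive_entry (m n : nat) (f : V -> 'M[R]_(m, n)) (x v : V) i j :
  differentiable f x -> ('D_v f x) i j = 'D_v (fun u => f u i j) x.
Proof. by move=> /diff_derivable df; rewrite derive_mx// mxE. Qed.

Lemma mulmx_entry (m n p : nat) (f : V -> 'M[R]_(m, n))
    (g : V -> 'M[R]_(n, p)) i j :
  (fun u => (f u *m g u) i j) =
  \sum_k ((fun u => f u i k) * (fun u => g u k j)).
Proof. by apply/funext => u; rewrite mxE fct_sumE. Qed.

Lemma differentiable_mulmx (m n p : nat) (f : V -> 'M[R]_(m, n))
    (g : V -> 'M[R]_(n, p)) (x : V) :
  differentiable f x -> differentiable g x ->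
  differentiable (fun u => f u *m g u) x.
Proof.
move=> /differentiable_mxP df /differentiable_mxP dg.
apply/differentiable_mxP => i j; rewrite mulmx_entry.
by apply: differentiable_sum => k; apply: differentiableM.
Qed.

Lemma derive_mulmx (m n p : nat) (f : V -> 'M[R]_(m, n))
    (g : V -> 'M[R]_(n, p)) (x v : V) :
  differentiable f x -> differentiable g x ->
  'D_v (fun u => f u *m g u) x = 'D_v f x *m g x + f x *m 'D_v g x.
Proof.
move=> df dg; have /differentiable_mxP dfe := df.
have /differentiable_mxP dge := dg; apply/matrixP => i j.
rewrite derive_entry; last exact: differentiable_mulmx.
rewrite mulmx_entry derive_sum; last first.
  by move=> k; apply: derivableM; apply: diff_derivable.
rewrite !mxE -big_split; apply: eq_bigr => k _ /=.
rewrite deriveM; [|exact: diff_derivable..].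
by rewrite !derive_entry// addrC; congr (_ + _); exact: mulrC.
Qed.

Lemma differentiable_trmx (m n : nat) (f : V -> 'M[R]_(m, n)) (x : V) :
  differentiable f x -> differentiable (fun u => (f u)^T) x.
Proof.
move=> /differentiable_mxP df; apply/differentiable_mxP => i j.
by under eq_fun do rewrite mxE.
Qed.

Lemma derive_trmx (m n : nat) (f : V -> 'M[R]_(m, n)) (x v : V) :
  differentiable f x -> 'D_v (fun u => (f u)^T) x = ('D_v f x)^T.
Proof.
move=> df; apply/matrixP => i j.
rewrite derive_entry ?mxE ?derive_entry//; last exact: differentiable_trmx.
by under eq_fun do rewrite mxE.
Qed.

End MatrixCalculus.

(** * Closure properties of the classes [Ck] on an open set *)

Section Smooth.
Context {R : realType} {n : nat}.
Implicit Types (U : set 'rV[R]_n) (k : nat).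

Lemma CkS {V : normedModType R} k U (f : 'rV[R]_n -> V) :
  Ck k.+1 U f -> Ck k U f.
Proof.
elim: k f => [|k IH] f [df Df].
  by move=> u Uu; apply: differentiable_continuous; apply: df.
by split=> // v; apply: IH; apply: Df.
Qed.

(** Since [U] is open, agreement on [U] is agreement of germs, so it passes to derivatives. This
    lets the product and quotient rules, known only on [U], replace the actual derivative in the
    inductions below. *)
Lemma eq_Ck {V : normedModType R} k U (f g : 'rV[R]_n -> V) :
  open U -> (forall u, U u -> f u = g u) -> Ck k U f -> Ck k U g.
Proof.
move=> oU; elim: k f g => [|k IH] f g fg.
  move=> cf u Uu; rewrite /prop_for /continuous_at -fg//.
  apply: cvg_trans (cf u Uu).
  have E : \forall y \near u, f y = g y := near_in_open oU Uu fg.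
  exact: near_eq_cvg E.
move=> [df Df]; split=> [u Uu|v].
  apply: near_eq_differentiable (df _ Uu).
  exact: (near_in_open (P := fun y => f y = g y) oU Uu).
apply: IH (Df v) => u Uu; apply: near_eq_derive.
exact: (near_in_open (P := fun y => f y = g y) oU Uu).
Qed.

Lemma Ck_cst {V : normedModType R} k U (a : V) : Ck k U (fun=> a).
Proof.
elim: k a => [|k IH] a; first by move=> u _; exact: (@cst_continuous _ _ a).
split=> [u _|v]; first exact: differentiable_cst.
under eq_fun do rewrite derive_cst.
exact: IH.
Qed.

Lemma CkD {V : normedModType R} k U (f g : 'rV[R]_n -> V) : open U ->
  Ck k U f -> Ck k U g -> Ck k U (f + g).
Proof.
move=> oU; elim: k f g => [|k IH] f g.
  by move=> cf cg u Uu; exact: (cvgD (cf u Uu) (cg u Uu)).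
move=> [df Df] [dg Dg]; split=> [u Uu|v].
  by apply: differentiableD; [exact: df|exact: dg].
apply: eq_Ck (IH _ _ (Df v) (Dg v)) => // u Uu.
by rewrite deriveD//; apply: diff_derivable; [exact: df|exact: dg].
Qed.

Lemma Ck_sum {V : normedModType R} (I : Type) (r : seq I) (P : pred I) k U
    (F : I -> 'rV[R]_n -> V) : open U ->
  (forall i, P i -> Ck k U (F i)) -> Ck k U (\sum_(i <- r | P i) F i).
Proof.
move=> oU CF; elim/big_ind : _ => [|f g|//]; first exact: Ck_cst.
exact: CkD.
Qed.

Lemma CkM k U (f g : 'rV[R]_n -> R) : open U ->
  Ck k U f -> Ck k U g -> Ck k U (f * g).
Proof.
move=> oU; elim: k f g => [|k IH] f g.
  by move=> cf cg u Uu; exact: (cvgM (cf u Uu) (cg u Uu)).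
move=> Cf Cg; have [df Df] := Cf; have [dg Dg] := Cg.
split=> [u Uu|v].
  by apply: differentiableM; [exact: df|exact: dg].
(* The product rule pairs each derivative with an undifferentiated factor; [CkS] lowers that factor
   to the order of the induction hypothesis. *)
have CD := CkD oU (IH _ _ (CkS Cf) (Dg v)) (IH _ _ (CkS Cg) (Df v)).
apply: eq_Ck CD => // u Uu.
by rewrite deriveM//; apply: diff_derivable; [exact: df|exact: dg].
Qed.

Lemma Ck_prod (I : Type) (r : seq I) (P : pred I) k U
    (F : I -> 'rV[R]_n -> R) : open U ->
  (forall i, P i -> Ck k U (F i)) -> Ck k U (\prod_(i <- r | P i) F i).
Proof.
move=> oU CF; elim/big_ind : _ => [|f g|//]; first exact: (Ck_cst _ _ (1 : R)).
exact: CkM.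
Qed.

Lemma CkV k U (f : 'rV[R]_n -> R) : open U -> (forall u, U u -> f u != 0) ->
  Ck k U f -> Ck k U (fun u => (f u)^-1).
Proof.
move=> oU f0; elim: k => [|k IH].
  by move=> cf u Uu; exact: (cvgV (f0 u Uu) (cf u Uu)).
move=> Cf; have [df Df] := Cf; split=> [u Uu|v].
  by apply: differentiableV; [exact: df|exact: f0].
have CfV := IH (CkS Cf).
(* The right-hand side is [- f^-1 * f^-1 * Df], which involves only the inverse one order lower. *)
have CD := CkM oU (Ck_cst k U (-1 : R)) (CkM oU (CkM oU CfV CfV) (Df v)).
apply: eq_Ck CD => // u Uu.
rewrite deriveV; [|exact: f0|apply: diff_derivable; exact: df].
by rewrite !fctE mulN1r -invfM -expr2 -mulNr.
Qed.

Lemma Ck_mxP (p q : nat) k U (f : 'rV[R]_n -> 'M[R]_(p, q)) : open U ->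
  Ck k U f <-> forall i j, Ck k U (fun u => f u i j).
Proof.
move=> oU; elim: k f => [|k IH] f.
  split=> [cf i j u Uu|cf u Uu].
    have := @cvg_comp _ _ _ f (fun N : 'M[R]_(p, q) => N i j) _ _ _ (cf _ Uu).
    by apply; exact: coord_continuous.
  apply/(@cvgrPdist_le _ _ _ (nbhs u) (nbhs_filter u)) => /= e e0; near=> y.
  rewrite [leLHS]/Num.Def.normr/= mx_normrE (bigmax_le _ (ltW e0))//= => i _.
  rewrite !mxE/=; move: i; near: y; apply: filter_forall => /= i.
  exact: (cvgrPdist_le _ _).1 (cf i.1 i.2 _ Uu) _ e0.
split=> [[df Df] i j|Cf].
  split=> [u Uu|v]; first by move: (df _ Uu) => /differentiable_mxP; apply.
  have /IH/(_ i j) := Df v; apply: eq_Ck => // u Uu.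
  by rewrite derive_entry//; exact: df.
have df u : U u -> differentiable f u.
  by move=> Uu; apply/differentiable_mxP => i j; have [d _] := Cf i j; exact: d.
split=> // v; apply/IH => i j; have [_ /(_ v)] := Cf i j.
by apply: eq_Ck => // u Uu; rewrite derive_entry//; exact: df.
Unshelve. all: by end_near. Qed.

Lemma Ck_det (p : nat) k U (f : 'rV[R]_n -> 'M[R]_p) : open U ->
  Ck k U f -> Ck k U (fun u => \det (f u)).
Proof.
move=> oU /(Ck_mxP _ _ oU) Cf.
have -> : (fun u => \det (f u)) =
    \sum_(s : 'S_p) ((fun=> (-1) ^+ s) * \prod_i (fun u => f u i (s i))).
  apply/funext => u; rewrite fct_sumE; apply: eq_bigr => s _.
  by rewrite !fctE fct_prodE.
apply: Ck_sum => // s _; apply: CkM => //; first exact: (Ck_cst _ _ (_ : R)).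
by apply: Ck_prod.
Qed.

(** Cramer's rule: cofactors are signed minors, and the determinant does not vanish on [U]. At a
    singular matrix [invmx] returns its argument, so the formula is compared with [invmx] on [U]
    only. *)
Lemma Ck_invmx (p : nat) k U (f : 'rV[R]_n -> 'M[R]_p) : open U ->
  (forall u, U u -> f u \in unitmx) ->
  Ck k U f -> Ck k U (fun u => invmx (f u)).
Proof.
move=> oU fu Cf; apply/(Ck_mxP _ _ oU) => i j.
have Cadj : Ck k U (fun u => \adj (f u) i j).
  have -> : (fun u => \adj (f u) i j) =
      (fun=> (-1) ^+ (j + i)) * (fun u => \det (row' j (col' i (f u)))).
    by apply/funext => u; rewrite mxE.
  apply: CkM => //; first exact: (Ck_cst _ _ (_ : R)).
  apply: Ck_det => //; apply/(Ck_mxP _ _ oU) => a b.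
  by under eq_fun do rewrite !mxE; move: Cf => /(Ck_mxP _ _ oU); apply.
have Cdet : Ck k U (fun u => (\det (f u))^-1).
  apply: CkV => //; last exact: Ck_det.
  by move=> u /fu; rewrite unitmxE unitfE.
apply: eq_Ck (CkM oU Cdet Cadj) => // u Uu.
by rewrite /invmx fu// mxE.
Qed.

End Smooth.

(** * Pointwise algebra of the Levi-Civita connection *)

Section Koszul.
Context {F : numFieldType} {n : nat}.
Variables (G : 'M[F]_n) (dG : 'I_n -> 'M[F]_n).
Hypotheses (Gu : G \in unitmx) (Gs : G^T = G).

(** Row [j] of [koszul i] is [nabla_i d_j] for the metric [G] with partial
    derivatives [dG]. *)
Definition koszul (i : 'I_n) : 'M[F]_n :=
  \matrix_(j, k) (2^-1 * \sum_l invmx G k l * (dG i j l + dG j i l - dG l i j)).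

Lemma invmx_sym k l : invmx G k l = invmx G l k.
Proof. by rewrite -[in RHS]Gs -trmx_inv mxE. Qed.

(** Lowering the index with [G] cancels the inverse metric and leaves the Christoffel symbols of the
    first kind. *)
Lemma koszul_mulmx i j l :
  (koszul i *m G) j l = 2^-1 * (dG i j l + dG j i l - dG l i j).
Proof.
pose w := \row_l (2^-1 * (dG i j l + dG j i l - dG l i j)).
have -> : (koszul i *m G) j l = (w *m invmx G *m G) 0 l.
  rewrite !mxE; apply: eq_bigr => k _; rewrite !mxE mulr_sumr; congr (_ * _).
  by apply: eq_bigr => m _; rewrite mxE invmx_sym mulrCA mulrC.
by rewrite mulmxKV// mxE.
Qed.

(** The uniqueness half of the fundamental theorem of Riemannian geometry: the hypotheses say
    torsion-free and metric. With lowered indices, the alternating sum of three derivatives of [G]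
    collapses to twice one entry of [C i *m G]. *)
Lemma koszul_unique (C : 'I_n -> 'M[F]_n) :
  (forall i j k, C i j k = C j i k) ->
  (forall i, dG i = C i *m G + (C i *m G)^T) ->
  C =1 koszul.
Proof.
move=> Csym dGE i; apply: (can_inj (mulmxK Gu)); apply/matrixP => j l.
have sym a b c : (C a *m G) b c = (C b *m G) a c.
  by rewrite !mxE; apply: eq_bigr => k _; rewrite Csym.
have dE a b c : dG a b c = (C a *m G) b c + (C a *m G) c b.
  by rewrite dGE mxE [X in _ + X]mxE.
rewrite koszul_mulmx !dE.
by rewrite (sym j i) (sym l i) (sym l j) (sym i l) (sym j l); field.
Qed.

(** In the lowered symbol, the last two terms are antisymmetric in [j] and [l], so adding the
    transpose removes them. *)
Lemma koszul_metric : (forall i, (dG i)^T = dG i) ->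
  forall i, dG i = koszul i *m G + (koszul i *m G)^T.
Proof.
move=> dGs i; apply/matrixP => j l.
rewrite mxE [X in _ + X]mxE !koszul_mulmx.
have -> : dG i l j = dG i j l by rewrite -[in LHS]dGs mxE.
by field.
Qed.

(** Exchanging [i] and [j] swaps the first two terms; the third is fixed because each [dG l] is
    symmetric. *)
Lemma koszul_sym : (forall i, (dG i)^T = dG i) ->
  forall i j k, koszul i j k = koszul j i k.
Proof.
move=> dGs i j k; rewrite !mxE; congr (_ * _); apply: eq_bigr => l _.
congr (_ * _); rewrite [dG i j l + _]addrC; congr (_ - _).
by rewrite -[in LHS](dGs l) mxE.
Qed.

End Koszul.

(** * Changes of chart and the chart representations of tensors *)

Section Charts.
Context {R : realType} {n : nat} {M : manifold R n}.
Implicit Types (x y : M) (c : chart M) (U : set M).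

Lemma near_chart c U x : open U -> U x -> cdom c x ->
  \forall u \near cmap c x,
    [/\ U (cinv c u), cdom c (cinv c u) & cmap c (cinv c u) = u].
Proof.
move=> oU Ux cx.
have cu : (cmap c @` cdom c) (cmap c x) by exists x.
have ci := @cinv_continuous _ _ _ _ _ cu.
have oW : open (U `&` cdom c) by apply: openI => //; exact: cdom_open.
have nW : nbhs (cinv c (cmap c x)) (U `&` cdom c).
  by apply: open_nbhs_nbhs; split=> //; rewrite cmapK.
have nI : nbhs (cmap c x) (cmap c @` cdom c).
  by apply: open_nbhs_nbhs; split=> //; exact: cimg_open.
have nU : \forall u \near cmap c x, (U `&` cdom c) (cinv c u) := ci _ nW.
near=> u.
have [] : (U `&` cdom c) (cinv c u) by near: u.
have [y cy <-] : (cmap c @` cdom c) u by near: u.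
by rewrite cmapK.
Unshelve. all: by end_near. Qed.

Lemma differentiable_transition c c' x : cdom c x -> cdom c' x ->
  differentiable (cmap c' \o cinv c) (cmap c x).
Proof.
move=> cx c'x; have [d _] := @transition_smooth _ _ M c c' 1%N.
by apply: d; exists x.
Qed.

(** Chain rule for the two transition maps, whose composite is the identity near [cmap c x]. *)
Lemma changeM c c' x : cdom c x -> cdom c' x ->
  change c c' x *m change c' c x = 1%:M.
Proof.
move=> cx c'x; apply/row_matrixP => i; rewrite !rowE mulmx1 mulmxA /change.
have d1 := differentiable_transition cx c'x.
have d2 := differentiable_transition c'x cx.
have E : (cmap c' \o cinv c) (cmap c x) = cmap c' x by rewrite /= cmapK.
(* The base point of the second Jacobian is put in the form of an image under the first transition
   map, as the chain rule expects. *)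
rewrite -{}E in d2 *.
set v := delta_mx 0 i.
rewrite -!deriveEjacobian// (deriveE _ d1) (deriveE _ d2).
have /= <- := congr1 (@^~ v) (diff_comp d1 d2).
rewrite -deriveE; last exact: differentiable_comp.
rewrite -[RHS](derive_id (cmap c x)); apply: near_eq_derive.
have := near_chart (cdom_open c') c'x cx.
by apply: filterS => u [c'u cu uE] /=; rewrite cmapK.
Qed.

Lemma change_id c x : cdom c x -> change c c x = 1%:M.
Proof.
move=> cx; apply/row_matrixP => i; rewrite !rowE mulmx1 /change.
rewrite -deriveEjacobian; last exact: differentiable_transition.
rewrite -[RHS](derive_id (cmap c x)); apply: near_eq_derive.
by have := near_chart openT I cx; apply: filterS => u [].
Qed.

Lemma vec_chart_at (X : M -> 'rV[R]_n) x : vec_chart X (chart_at x) x = X x.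
Proof. by rewrite /vec_chart change_id ?mulmx1//; exact: chart_atP. Qed.

Lemma end_chart_at (A : M -> 'M[R]_n) x : end_chart A (chart_at x) x = A x.
Proof.
by rewrite /end_chart change_id ?mulmx1 ?mul1mx//; exact: chart_atP.
Qed.

Lemma form_chart_at (g : M -> 'M[R]_n) x : form_chart g (chart_at x) x = g x.
Proof.
by rewrite /form_chart change_id ?trmx1 ?mulmx1 ?mul1mx//; exact: chart_atP.
Qed.

Lemma vec_chart_app_end (A : M -> 'M[R]_n) (Y : M -> 'rV[R]_n) c y :
  cdom c y -> vec_chart (app_end A Y) c y = vec_chart Y c y *m end_chart A c y.
Proof.
move=> cy; rewrite /vec_chart /end_chart /app_end.
have := changeM (chart_atP y) cy.
move: (change c _ y) (change _ c y) => P Q QP.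
by rewrite !mulmxA -[_ *m Q *m P]mulmxA QP mulmx1.
Qed.

Lemma form_chart_pull (A g : M -> 'M[R]_n) c y : cdom c y ->
  form_chart (pull_metric A g) c y =
  end_chart A c y *m form_chart g c y *m (end_chart A c y)^T.
Proof.
move=> cy; rewrite /form_chart /end_chart /pull_metric.
have := changeM (chart_atP y) cy.
move: (change c _ y) (change _ c y) => P Q QP.
rewrite !trmx_mul !mulmxA -[_ *m Q *m P]mulmxA QP mulmx1.
by rewrite -[_ *m P^T *m Q^T]mulmxA -trmx_mul QP trmx1 mulmx1.
Qed.

Lemma end_chart_inv (A : M -> 'M[R]_n) c y : cdom c y -> A y \in unitmx ->
  end_chart A c y \in unitmx /\
  end_chart (inv_end A) c y = invmx (end_chart A c y).
Proof.
move=> cy Ay.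
have E : end_chart A c y *m end_chart (inv_end A) c y = 1%:M.
  rewrite /end_chart /inv_end -(changeM cy (chart_atP y)).
  have := changeM (chart_atP y) cy.
  move: (change c _ y) (change _ c y) => P Q QP.
  rewrite !mulmxA -[_ *m Q *m P]mulmxA QP mulmx1.
  by rewrite -[_ *m A y *m _]mulmxA mulmxV// mulmx1.
have [uA _] := mulmx1_unit E; split=> //.
by rewrite -[RHS]mulmx1 -E mulKmx.
Qed.

(** The Christoffel term is regrouped into one connection matrix per direction, so that the rest is
    matrix algebra. *)
Lemma nablaE (g : M -> 'M[R]_n) (Y : M -> 'rV[R]_n) x (X : 'rV[R]_n) :
  let c := chart_at x in
  let G := form_chart g c \o cinv c in
  nabla g Y x X = 'D_X (vec_chart Y c \o cinv c) (cmap c x) +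
    \sum_i X 0 i *: (Y x *m koszul (G (cmap c x))
      (fun l => 'D_(delta_mx 0 l) G (cmap c x)) i).
Proof.
move=> c G; rewrite /nabla -/c; congr (_ + _); apply/rowP => k.
rewrite mxE summxE; apply: eq_bigr => i _; rewrite !mxE mulr_sumr.
by apply: eq_bigr => j _; rewrite mxE -mulrA mulrC -mulrA.
Qed.

End Charts.

Lemma derive_sum_delta (R : realType) (n : nat) (W : normedModType R)
    (f : 'rV[R]_n -> W) (u X : 'rV[R]_n) : differentiable f u ->
  'D_X f u = \sum_i X 0 i *: 'D_(delta_mx 0 i) f u.
Proof.
move=> df; rewrite deriveE// {1}(row_sum_delta X) linear_sum.
by apply: eq_bigr => i _; rewrite linearZ deriveE.
Qed.

(** * Pointwise properties of metrics, and locality of the connection *)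

Section Metric.
Context {R : realType} {n : nat} {M : manifold R n} {g : M -> 'M[R]_n}.
Hypothesis hg : riemannian_metric g.

Lemma metric_sym x : (g x)^T = g x.
Proof.
have [_ gs _] := hg; apply/matrixP => i j; rewrite mxE.
have := gs x (delta_mx 0 j) (delta_mx 0 i).
by rewrite /inner !trmx_delta -!rowE -!colE !mxE.
Qed.

Lemma metric_unit x : g x \in unitmx.
Proof.
have [_ _ gp] := hg; rewrite -row_free_unit -kermx_eq0; apply/rowV0P => v.
move=> /sub_kermxP vg; apply/eqP/negPn/negP => /(gp x).
by rewrite /inner vg mul0mx mxE ltxx.
Qed.

Lemma form_chart_sym c y : (form_chart g c y)^T = form_chart g c y.
Proof. by rewrite /form_chart !trmx_mul trmxK metric_sym mulmxA. Qed.

End Metric.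

Section Fields.
Context {R : realType} {n : nat} {M : manifold R n}.

Lemma eq_nabla (g : M -> 'M[R]_n) (U : set M) (Y Z : M -> 'rV[R]_n) x X :
  open U -> U x -> (forall y, U y -> Y y = Z y) ->
  nabla g Y x X = nabla g Z x X.
Proof.
move=> oU Ux YZ; rewrite !nablaE (YZ x Ux); congr (_ + _).
apply: near_eq_derive.
have := near_chart oU Ux (chart_atP x); apply: filterS => u [Uu _ _] /=.
by rewrite /vec_chart YZ.
Qed.

Lemma smooth_field_differentiable {V : normedModType R} (U : set M)
    (f : chart M -> M -> V) x : smooth_field U f -> U x ->
  differentiable (f (chart_at x) \o cinv (chart_at x)) (cmap (chart_at x) x).
Proof.
move=> sf Ux; have [d _] := sf (chart_at x) 1%N; apply: d.
by exists x => //; split=> //; exact: chart_atP.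
Qed.

End Fields.

(** * The Levi-Civita connection of the metric pulled back by a Codazzi tensor *)

Section PullBack.
Context {R : realType} {n : nat} {M : manifold R n}.
Variables (g A : M -> 'M[R]_n).
Hypotheses (hg : riemannian_metric g) (hA : codazzi_tensor g A).
Hypothesis hAinv : invertible_end A.
Variables (x : M) (U : set M) (E : 'I_n -> M -> 'rV[R]_n).
Hypotheses (oU : open U) (Ux : U x) (sE : forall k, smooth_vec U (E k)).
Hypothesis Eu : (\matrix_(k < n) E k x) \in unitmx.

Let c := chart_at x.
Let u0 := cmap c x.
Let a := end_chart A c \o cinv c.
Let G := form_chart g c \o cinv c.
Let G' := form_chart (pull_metric A g) c \o cinv c.
Let K := koszul (G u0) (fun l => 'D_(delta_mx 0 l) G u0).
Let K' := koszul (G' u0) (fun l => 'D_(delta_mx 0 l) G' u0).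

Let cinv0 : cinv c u0 = x.
Proof. by rewrite cmapK//; exact: chart_atP. Qed.

Let a0 : a u0 = A x.
Proof. by rewrite /a /= cinv0 end_chart_at. Qed.

Let G0 : G u0 = g x.
Proof. by rewrite /G /= cinv0 form_chart_at. Qed.

Let da : differentiable a u0.
Proof. by have [sA _ _] := hA; exact: (smooth_field_differentiable sA). Qed.

Let dG : differentiable G u0.
Proof. by have [sG _ _] := hg; exact: (smooth_field_differentiable sG). Qed.

(** Row [j] of [T i] is [nabla_i (A d_j)] in the chart; the Christoffel symbols
    of [A^* g] will be [K' i = T i *m A^-1]. *)
Let T i := 'D_(delta_mx 0 i) a u0 + a u0 *m K i.

Let dGs i : ('D_(delta_mx 0 i) G u0)^T = 'D_(delta_mx 0 i) G u0.
Proof.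
have GT : (fun u => (G u)^T) = G.
  by apply/funext => u; exact: form_chart_sym.
by rewrite -derive_trmx// GT.
Qed.

Let Ksym i j k : K i j k = K j i k.
Proof. exact: koszul_sym. Qed.

(** Leibniz rule in the chart: near [u0] the field [A Y] is represented by a matrix product, and the
    derivative of [a] combines with the Christoffel term into [T]. *)
Lemma nabla_app_end (Y : M -> 'rV[R]_n) X :
  differentiable (vec_chart Y c \o cinv c) u0 ->
  nabla g (app_end A Y) x X =
  'D_X (vec_chart Y c \o cinv c) u0 *m A x + \sum_i X 0 i *: (Y x *m T i).
Proof.
move=> dY; rewrite nablaE -/c -/u0 -/G -/K.
have -> : 'D_X (vec_chart (app_end A Y) c \o cinv c) u0 =
    'D_X (fun u => (vec_chart Y c \o cinv c) u *m a u) u0.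
  apply: near_eq_derive.
  have := near_chart openT I (chart_atP x); apply: filterS => u [_ cu _] /=.
  by rewrite vec_chart_app_end.
rewrite derive_mulmx// a0 -addrA; congr (_ + _).
rewrite (derive_sum_delta _ da) /= cinv0 vec_chart_at mulmx_sumr -big_split /=.
apply: eq_bigr => i _; rewrite -scalemxAr -scalerDr; congr (_ *: _).
by rewrite /T mulmxDr a0 /app_end mulmxA.
Qed.

(** Row [j] of [B i] is [(nabla_i A) d_j]. *)
Let B i := T i - K i *m a u0.

Let nabla_endE X Y : smooth_vec U Y ->
  nabla_end g A X Y x = \sum_i X x 0 i *: (Y x *m B i).
Proof.
move=> sY; have dY := smooth_field_differentiable sY Ux.
rewrite /nabla_end nabla_app_end// nablaE -/c -/u0 -/G -/K.
rewrite mulmxDl opprD addrACA subrr add0r mulmx_suml -sumrB.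
apply: eq_bigr => i _; rewrite -scalemxAl -scalerBr; congr (_ *: _).
by rewrite /B mulmxBr a0 mulmxA.
Qed.

(** By tensoriality, the Codazzi equation for the fields [E] of a frame implies
    it for the coordinate fields, whose smoothness need not be checked. *)
Let Bsym i j k : B i j k = B j i k.
Proof.
pose F := \matrix_(k < n) E k x.
pose Bk := \matrix_(i, j) B i j k.
have BkE p q : (F *m Bk *m F^T) p q = nabla_end g A (E p) (E q) x 0 k.
  rewrite nabla_endE// -mulmxA mxE summxE; apply: eq_bigr => l _.
  rewrite !mxE; congr (_ * _); apply: eq_bigr => m _.
  by rewrite !mxE mulrC.
(* For fixed [k], the entries of [F *m Bk *m F^T] are the [k]-th components of
   [(nabla_{E_p} A) E_q]. The Codazzi equation makes this matrix symmetric, and the invertible [F]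
   can then be cancelled on both sides. *)
have : F *m Bk *m F^T = F *m Bk^T *m F^T.
  have -> : F *m Bk^T *m F^T = (F *m Bk *m F^T)^T.
    by rewrite !trmx_mul trmxK mulmxA.
  apply/matrixP => p q.
  have [_ _ /(_ U _ _ oU (sE p) (sE q) x Ux) Acod] := hA.
  by rewrite [RHS]mxE !BkE Acod.
have Fu : F^T \in unitmx by rewrite unitmx_tr.
move=> /(can_inj (mulmxK Fu)) /(can_inj (mulKmx Eu)) /matrixP/(_ i j).
by rewrite !mxE.
Qed.

(** [T] is the sum of [B], symmetric by Codazzi, and [K *m a], symmetric because the connection of
    [g] is torsion-free. *)
Let Tsym i j k : T i j k = T j i k.
Proof.
have TE p q : T p q k = B p q k + (K p *m a u0) q k.
  by rewrite /B [in RHS]mxE [X in _ + X + _]mxE subrK.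
rewrite !TE Bsym !mxE; congr (_ + _); apply: eq_bigr => l _.
by rewrite Ksym.
Qed.

Let au : a u0 \in unitmx.
Proof. by rewrite a0. Qed.

Let G'E : \forall u \near u0, G' u = a u *m G u *m (a u)^T.
Proof.
have := near_chart openT I (chart_atP x); apply: filterS => u [_ cu _].
exact: form_chart_pull.
Qed.

Let G'0 : G' u0 = a u0 *m G u0 *m (a u0)^T.
Proof. exact: (nbhs_singleton G'E). Qed.

(** Differentiate [a *m G *m a^T]. Metric compatibility of [K] splits the middle term into
    [a *m K i *m G *m a^T] and its transpose, which complete the two outer terms from ['D a] to
    [T i]. *)
Let dG'E i : 'D_(delta_mx 0 i) G' u0 =
  T i *m G u0 *m (a u0)^T + (T i *m G u0 *m (a u0)^T)^T.
Proof.
have -> : 'D_(delta_mx 0 i) G' u0 =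
    'D_(delta_mx 0 i) (fun u => a u *m G u *m (a u)^T) u0.
  exact: near_eq_derive.
have daG := differentiable_mulmx da dG.
rewrite derive_mulmx//; last exact: differentiable_trmx.
rewrite derive_mulmx// derive_trmx// /T.
have -> : 'D_(delta_mx 0 i) G u0 = K i *m G u0 + (K i *m G u0)^T.
  apply: koszul_metric => //; rewrite G0; first exact: metric_unit.
  exact: metric_sym.
have Gs : (G u0)^T = G u0 by rewrite G0 metric_sym.
move: (a u0) (G u0) Gs (K i) ('D_ _ a u0) => a1 G1 Gs K1 D1.
have TT : (D1 + a1 *m K1)^T = D1^T + K1^T *m a1^T.
  by rewrite -trmx_mul; apply/matrixP => p q; rewrite !mxE.
rewrite !trmx_mul trmxK Gs TT.
rewrite !(mulmxDl, mulmxDr) !mulmxA -!addrA; congr (_ + (_ + _)).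
by rewrite addrC.
Qed.

(** The matrices [T i *m invmx (a u0)] are torsion-free by [Tsym] and metric for [G'] by [dG'E], so
    [koszul_unique] identifies them with [K']. *)
Let K'E i : K' i *m a u0 = T i.
Proof.
suff <- : T i *m invmx (a u0) = K' i by rewrite mulmxKV.
apply: (@koszul_unique _ _ _ _ _ _ (fun i => T i *m invmx (a u0))).
- have Gu : G u0 \in unitmx by rewrite G0; exact: metric_unit.
  rewrite G'0; move: (a u0) (G u0) au Gu => a1 G1 a1u G1u.
  by rewrite !unitmx_mul unitmx_tr a1u G1u.
- rewrite G'0 G0; move: (a u0) => a1.
  by rewrite !trmx_mul trmxK metric_sym// mulmxA.
- by move=> p q k; rewrite !mxE; apply: eq_bigr => l _; rewrite Tsym.
- move=> p; rewrite dG'E G'0; move: (a u0) (G u0) (T p) au => a1 G1 T1 a1u.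
  by rewrite !mulmxA mulmxKV.
Qed.

Lemma nabla_pull_metric (Y : M -> 'rV[R]_n) X :
  differentiable (vec_chart Y c \o cinv c) u0 ->
  nabla (pull_metric A g) Y x X *m A x = nabla g (app_end A Y) x X.
Proof.
move=> dY; rewrite nabla_app_end// nablaE -/c -/u0 -/G' -/K' mulmxDl.
congr (_ + _); rewrite mulmx_suml; apply: eq_bigr => i _.
by rewrite -scalemxAl -mulmxA -a0 K'E.
Qed.

End PullBack.

(** * Scaling and inversion of endomorphism fields *)

Lemma inner_pull_metric (R : realType) (n : nat) (M : manifold R n)
    (A g : M -> 'M[R]_n) x X Y :
  inner (pull_metric A g) x X Y = inner g x (X *m A x) (Y *m A x).
Proof. by rewrite /inner /pull_metric trmx_mul !mulmxA. Qed.

Lemma end_chartZ (R : realType) (n : nat) (M : manifold R n)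
    (B : M -> 'M[R]_n) (a : R) c y :
  end_chart (fun x => a *: B x) c y = a *: end_chart B c y.
Proof. by rewrite /end_chart -scalemxAr -scalemxAl. Qed.

Lemma nablaZ (R : realType) (n : nat) (M : manifold R n) (g : M -> 'M[R]_n)
    (Y : M -> 'rV[R]_n) (a : R) x X :
  differentiable (vec_chart Y (chart_at x) \o cinv (chart_at x))
    (cmap (chart_at x) x) ->
  nabla g (fun y => a *: Y y) x X = a *: nabla g Y x X.
Proof.
move=> dY; rewrite !nablaE scalerDr; congr (_ + _).
  rewrite -deriveZ; last exact: diff_derivable.
  set f := (X in 'D_ _ X _); set h := (X in _ = 'D_ _ X _).
  suff -> : f = h by [].
  by apply/funext => u; rewrite /f /= /vec_chart -scalemxAl.
rewrite scaler_sumr; apply: eq_bigr => i _.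
by rewrite -scalemxAl !scalerA mulrC.
Qed.

Lemma differentiable_app_end (R : realType) (n : nat) (M : manifold R n)
    (A : M -> 'M[R]_n) (Y : M -> 'rV[R]_n) c x : cdom c x ->
  differentiable (end_chart A c \o cinv c) (cmap c x) ->
  differentiable (vec_chart Y c \o cinv c) (cmap c x) ->
  differentiable (vec_chart (app_end A Y) c \o cinv c) (cmap c x).
Proof.
move=> cx dA dY; have := differentiable_mulmx dY dA.
apply: near_eq_differentiable.
have := near_chart openT I cx; apply: filterS => u [_ cu _].
by rewrite /= vec_chart_app_end.
Qed.

Lemma smooth_end_scale_inv (R : realType) (n : nat) (M : manifold R n)
    (A : M -> 'M[R]_n) (a : R) : smooth_end A -> invertible_end A ->
  smooth_end (fun x => a *: inv_end A x).
Proof.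
move=> sA Au c k; have oW : open (cmap c @` (setT `&` cdom c)).
  by rewrite setTI; exact: cimg_open.
have uE u : (cmap c @` (setT `&` cdom c)) u ->
    cdom c (cinv c u).
  by move=> [y [_ cy] <-]; rewrite cmapK.
have Cinv : Ck k (cmap c @` (setT `&` cdom c))
    (fun u => invmx ((end_chart A c \o cinv c) u)).
  apply: Ck_invmx (sA c k) => // u /uE cu /=.
  by have [] := end_chart_inv cu (Au (cinv c u)).
apply/(Ck_mxP _ _ oW) => i j; move/(Ck_mxP _ _ oW) : Cinv => /(_ i j) Cij.
apply: eq_Ck (CkM oW (Ck_cst _ _ (a : R)) Cij) => // u /uE cu.
transitivity ((a *: end_chart (inv_end A) c (cinv c u)) i j).
  by rewrite (end_chart_inv cu (Au _)).2 mxE.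
by rewrite -end_chartZ.
Qed.

Lemma cliffZ (R : realType) (n : nat) (S : spinor_module R n) (a : R)
    (v : 'rV[R]_n) : cliff S (a *: v) = a%:C%C *: cliff S v.
Proof.
rewrite /cliff scaler_sumr; apply: eq_bigr => k _.
by rewrite mxE rmorphM scalerA.
Qed.

(** * Comparison of the spin connections and Clifford multiplications *)

Section SpinPullBack.
Context {R : realType} {n : nat} {M : manifold R n} {S : spinor_module R n}.

Lemma frame_unit (g : M -> 'M[R]_n) (o : M -> R) (Q : spin_structure S g o)
    (p : pspin Q) : frame p \in unitmx.
Proof.
have := frame_orthonormal p.
by rewrite -mulmxA => /mulmx1_unit [].
Qed.

Variables (g A : M -> 'M[R]_n) (o : M -> R) (Q : spin_structure S g o).
Hypotheses (hg : riemannian_metric g) (hA : codazzi_tensor g A).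
Hypothesis hAinv : invertible_end A.

(** The smooth local frame on which the Codazzi equation is tested comes from a local section of the
    spin structure [Q]. *)
Lemma nabla_pull (Y : M -> 'rV[R]_n) x X :
  differentiable (vec_chart Y (chart_at x) \o cinv (chart_at x))
    (cmap (chart_at x) x) ->
  nabla (pull_metric A g) Y x X *m A x = nabla g (app_end A Y) x X.
Proof.
move=> dY; have [V [s [Vs Vx]]] := psec_cover Q x.
have [oV _ _] := (psecP V s).1 Vs.
apply: (nabla_pull_metric hg hA hAinv oV Vx (frame_smooth Vs)).
  suff -> : \matrix_k row k (frame (s x)) = frame (s x) by exact: frame_unit.
  by apply/row_matrixP => k; rewrite rowK.
exact: dY.
Qed.

Variables (Q' : spin_structure S (pull_metric A g) (push_orientation A o)).
Variable F : spin_identification Q Q'.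

Lemma psec_idi U (s : M -> pspin Q') : psec U s -> psec U (idi F \o s).
Proof.
move=> Us; apply/(idf_smooth F).
by have -> // : idf F \o (idi F \o s) = s by apply/funext => y; exact: idiK.
Qed.

Lemma frame_idi (p : pspin Q') : frame (idi F p) = frame p *m A (pproj p).
Proof.
by rewrite -{2 3}(idiK F p) idf_frame idf_proj mulmxKV.
Qed.

(** The frame at [idi F p] is [A] applied to the frame at [p], so [A X] has in it the components
    that [X] has in the latter. *)
Lemma cliff_mul_idi (p : pspin Q') X psi :
  cliff_mul p X psi = cliff_mul (idi F p) (X *m A (pproj p)) psi.
Proof.
rewrite /cliff_mul frame_idi; congr (cliff _ _ *m _).
apply: (can_inj (mulmxK (frame_unit p))); rewrite (mulmxKV (frame_unit p)).
apply: (can_inj (mulmxK (hAinv (pproj p)))).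
rewrite -[RHS]mulmxA mulmxKV//.
by rewrite unitmx_mul frame_unit hAinv.
Qed.

Lemma spinor_field_Phi phi : spinor_field phi -> spinor_field (Phi F phi).
Proof.
move=> [phiM phis]; split=> [p h sh|U s /psec_idi]; last exact: phis.
(* Equivariance of [idi F] is deduced from that of [idf F] by injectivity. *)
rewrite /Phi /= -phiM//; congr phi; apply: (can_inj (idfK F)).
by rewrite idiK idf_act// idiK.
Qed.

(** The derivative terms coincide by definition of [Phi]. For the connection coefficients, [A] sends
    the frame of [s] to that of [idi F \o s] on all of [U], so the fields may be exchanged under
    [nabla g]. *)
Lemma nabla_spin_Phi phi U (s : M -> pspin Q') x X : psec U s -> U x ->
  nabla_spin (Phi F phi) s x X = nabla_spin phi (idi F \o s) x X.
Proof.
move=> Us Ux; have [oU pU _] := (psecP U s).1 Us.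
rewrite /nabla_spin; congr (_ + _ *: _); apply: eq_bigr => k _.
apply: eq_bigr => l _; congr (_ *: _); congr (_%:C%C).
have eE j y : U y -> row j (frame (s y)) *m A y = row j (frame (idi F (s y))).
  by move=> Uy; rewrite frame_idi row_mul pU.
rewrite inner_pull_metric nabla_pull; last first.
  exact: (smooth_field_differentiable (frame_smooth Us k)).
rewrite eE//; congr inner; apply: (eq_nabla _ _ oU Ux) => y Uy.
exact: eE.
Qed.

Lemma codazzi_pull_inv (a : R) :
  codazzi_tensor (pull_metric A g) (fun x => a *: inv_end A x).
Proof.
have [sA Asym Acod] := hA; have sB := smooth_end_scale_inv a sA hAinv.
split=> // [x X Y|U X Y oU sX sY x Ux].
  rewrite !inner_pull_metric /inv_end -!scalemxAr -!scalemxAl !mulmxKV//.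
  by rewrite Asym -scalemxAl /inner linearZ /= -!scalemxAl -scalemxAr.
pose B x := a *: inv_end A x.
(* Multiplying by [A x] lets [nabla_pull] apply to [B Y']; since [A (B Y') = a Y'], both sides
   reduce to [a] times the difference of the two connections on [Y']. *)
have key (X' Y' : M -> 'rV[R]_n) : smooth_vec U Y' ->
    nabla_end (pull_metric A g) B X' Y' x *m A x =
    - (a *: (nabla_end g A X' Y' x *m invmx (A x))).
  move=> sY'; have dY' := smooth_field_differentiable sY' Ux.
  have dB := smooth_field_differentiable sB I.
  rewrite /nabla_end !mulmxBl nabla_pull; last first.
    by apply: differentiable_app_end => //; exact: chart_atP.
  have -> : app_end A (app_end B Y') = fun y => a *: Y' y.
    by apply/funext => y; rewrite /app_end /B -scalemxAr -scalemxAl mulmxKV.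
  rewrite nablaZ// -(nabla_pull _ dY').
  move: (nabla g Y' _ _) (nabla (pull_metric A g) Y' _ _) => N N'.
  rewrite /B -scalemxAr -!scalemxAl mulmxKV//.
  by rewrite !mulmxK// scalerBr opprB.
apply: (can_inj (mulmxK (hAinv x))).
by rewrite (key X Y)// (key Y X)// (Acod U X Y).
Qed.

End SpinPullBack.

Theorem proposition9 (R : realType) (n : nat) (M : manifold R n)
  (S : spinor_module R n) (g0 : M -> 'M[R]_n) (o : M -> R)
  (A : M -> 'M[R]_n) (Q : spin_structure S g0 o)
  (Q' : spin_structure S (pull_metric A g0) (push_orientation A o))
  (F : spin_identification Q Q')
  (hg0 : riemannian_metric g0) (ho : orientation o)
  (hA : codazzi_tensor g0 A) (hAinv : invertible_end A) :
  [/\ forall (phi : pspin Q -> 'cV[R[i]]_(sdim S)),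
        imaginary_codazzi_spinor A phi ->
        killing_spinor 'i%C (Phi F phi),
      forall (a : R) (phi : pspin Q -> 'cV[R[i]]_(sdim S)),
        killing_spinor ('i%C * a%:C%C) phi ->
        imaginary_codazzi_spinor (fun x => a *: inv_end A x) (Phi F phi) &
      forall (phi : pspin Q -> 'cV[R[i]]_(sdim S)),
        parallel_spinor phi -> parallel_spinor (Phi F phi)].
Proof.
have proj U (s : M -> pspin Q') x : psec U s -> U x -> pproj (s x) = x.
  by move=> /psecP[_ ps _]; exact: ps.
split=> [phi [_ sphi Hphi]|a phi [sphi Hphi]|phi [sphi Hphi]].
- split=> [|U s Us x Ux X]; first exact: spinor_field_Phi.
  rewrite (nabla_spin_Phi hg0 hA hAinv _ _ _ Us Ux).
  (* Clifford multiplication by [A X] in the gauge [idi F \o s] is multiplication by [X] in the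
     gauge [s]. *)
  rewrite (Hphi _ _ (psec_idi F Us) _ Ux) (cliff_mul_idi hAinv F).
  by rewrite (proj _ _ _ Us Ux).
- split=> [||U s Us x Ux X].
  + exact: (codazzi_pull_inv Q).
  + exact: spinor_field_Phi.
  rewrite (nabla_spin_Phi hg0 hA hAinv _ _ _ Us Ux).
  rewrite (Hphi _ _ (psec_idi F Us) _ Ux) (cliff_mul_idi hAinv F).
  (* The factor [A^-1] of the Codazzi tensor cancels the [A] from [cliff_mul_idi]; the real scalar
     [a] left over joins [i] in the Killing number. *)
  rewrite (proj _ _ _ Us Ux) -scalemxAr -scalemxAl mulmxKV//.
  by rewrite /cliff_mul -scalemxAl cliffZ -scalemxAl scalerA.
- split=> [|U s Us x Ux X]; first exact: spinor_field_Phi.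
  rewrite (nabla_spin_Phi hg0 hA hAinv _ _ _ Us Ux).
  exact: (Hphi _ _ (psec_idi F Us) _ Ux).
Qed.
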